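(* If $[\mathcal{Z}_K/G]$ is a quasi-toric orbifold or a complete toric Deligne–Mumford stack, with $R=T/G$, then $\mathbb{Z}[K]$ is torsion-free over $\mathbb{Z}[R^*]$.
   Context: Here $T=U(1)^m$, $R=U(1)^n$, $B$ is an integral $n\times m$ matrix inducing a surjection of tori $T\to R$, $G=\ker B$, and $\mathcal{Z}_K=\bigcup_{\sigma\in K}D^{\sigma}\times(\partial D)^{[m]\setminus\sigma}\subset\mathbb{C}^m$ is the moment angle complex ($D$ the closed unit disc) with coordinatewise $T$-action. The pair $(K,B)$ arises in one of two ways: (a) Quasi-toric orbifold: $\Delta$ is a simple $n$-dimensional polytope with facets $H_1,\dots,H_m$; for each vertex $H_{i_1}\cap\cdots\cap H_{i_n}$ of $\Delta$ the columns $i_1,\dots,i_n$ of $B$ form a basis of $\mathbb{Q}^n$; $K=K_\Delta=\{\sigma\subset[m]:\bigcap_{i\in\sigma}H_i\neq\varnothing\}$. (b) Complete toric Deligne–Mumford stack: $(\Sigma,\mathsf{b})$ is a complete labeled fan, i.e. a simplicial fan $\Sigma$ in $\mathbb{R}^n$ whose cones have union $\mathbb{R}^n$, with rays $\rho_1,\dots,\rho_m$ labeled by positive integers $\mathsf{b}_1,\dots,\mathsf{b}_m$; $\beta_i$ is the primitive integral generator of $\rho_i$, $B=[\mathsf{b}_1\beta_1,\dots,\mathsf{b}_m\beta_m]$, and $K$ is the simplicial complex of sets of rays spanning cones of $\Sigma$. $\mathbb{Z}[K]=\mathbb{Z}[x_1,\dots,x_m]/\langle\prod_{i\in\sigma}x_i:\sigma\notin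 K\rangle$ is a module over $\mathbb{Z}[R^*]=H^*(BR;\mathbb{Z})=\mathbb{Z}[u_1,\dots,u_n]\subset\mathbb{Z}[x_1,\dots,x_m]$, where $u_i=\sum_jB_{ij}x_j$. A module $M$ over a domain $S$ is torsion-free if no nonzero $x\in M$ is annihilated by a nonzero element of $S$. *)

(* Defs.v *)
From HB Require Import structures.
From mathcomp Require Import all_boot all_order all_algebra.
From mathcomp Require Import boolp classical_sets cardinality reals.
From mathcomp Require Import complex mpoly.

Set Implicit Arguments.
Unset Strict Implicit.
Unset Printing Implicit Defensive.

Import Order.TTheory GRing.Theory Num.Theory.

Local Open Scope classical_set_scope.
Local Open Scope ring_scope.
Local Open Scope quotient_scope.

(** * Face rings *)

(* Vertices [i] with [[set i]] not a face are allowed. *)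
Record simplicial_complex (m : nat) := SimplicialComplex {
  sc_faces :> {set {set 'I_m}};
  sc_set0 : finset.set0 \in sc_faces;
  sc_down : forall s t : {set 'I_m},
    s \subset t -> t \in sc_faces -> s \in sc_faces }.

Definition face_monomial (m : nat) (s : {set 'I_m}) : {mpoly int[m]} :=
  \prod_(i in s) 'X_i.

Definition face_ideal (m : nat) (K : simplicial_complex m)
    : {pred {mpoly int[m]}} :=
  fun p => `[< exists q : {set 'I_m} -> {mpoly int[m]},
     p = \sum_(s : {set 'I_m} | s \notin K) q s * face_monomial s >].

Lemma face_ideal_closed (m : nat) (K : simplicial_complex m) :
  idealr_closed (face_ideal K).
Proof.
split.
- by apply/asboolP; exists (fun=> 0); rewrite big1 // => s _; rewrite mul0r.
- apply/negP => /asboolP[q] /(congr1 (meval (fun=> 0))).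
  rewrite meval1 raddf_sum big1 => [/eqP|s sK]; first by rewrite oner_eq0.
  rewrite /= mevalM /face_monomial rmorph_prod.
  have [i si] : exists i, i \in s.
    by apply/set0Pn; apply: contraNneq sK => ->; exact: sc_set0.
  by rewrite (bigD1 i) //= mevalXU mul0r mulr0.
- move=> a _ _ /asboolP[q ->] /asboolP[r ->]; apply/asboolP.
  exists (fun s => a * q s + r s); rewrite mulr_sumr -big_split /=.
  by apply: eq_bigr => s _; rewrite mulrDl mulrA.
Qed.

HB.instance Definition _ (m : nat) (K : simplicial_complex m) :=
  isIdealr.Build {mpoly int[m]} (face_ideal K) (face_ideal_closed K).

Definition face_ring (m : nat) (K : simplicial_complex m) :=
  {ideal_quot face_ideal K}.

HB.instance Definition _ (m : nat) (K : simplicial_complex m) :=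
  GRing.ComNzRing.on (face_ring K).

Definition linear_form (n m : nat) (B : 'M[int]_(n, m)) (i : 'I_n)
    : {mpoly int[m]} :=
  \sum_(j < m) B i j *: 'X_j.

(* The ring map Z[u_1, .., u_n] -> Z[x_1, .., x_m]; it is injective as soon as
   B has rank n, in which case its image is the subring Z[R^*] of Z[x]. *)
Definition subst_u (n m : nat) (B : 'M[int]_(n, m)) (f : {mpoly int[n]})
    : {mpoly int[m]} :=
  f \mPo [tuple linear_form B i | i < n].

(* Z[K] as a module over Z[u_1, .., u_n] by restriction of scalars. *)
Definition face_module (n m : nat) (B : 'M[int]_(n, m))
  (K : simplicial_complex m) := face_ring K.

HB.instance Definition _ (n m : nat) (B : 'M[int]_(n, m))
    (K : simplicial_complex m) :=
  GRing.Zmodule.copy (face_module B K) (face_ring K).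

Definition face_scale (n m : nat) (B : 'M[int]_(n, m))
    (K : simplicial_complex m) (f : {mpoly int[n]}) (x : face_module B K)
    : face_module B K :=
  (\pi_({ideal_quot face_ideal K}) (subst_u B f) : face_ring K) *
  (x : face_ring K).

Fact face_scaleA n m (B : 'M[int]_(n, m)) (K : simplicial_complex m) f g
    (x : face_module B K) :
  face_scale f (face_scale g x) = face_scale (f * g) x.
Proof. by rewrite /face_scale mulrA /subst_u rmorphM [in RHS]rmorphM. Qed.

Fact face_scale1 n m (B : 'M[int]_(n, m)) (K : simplicial_complex m) :
  left_id 1 (@face_scale n m B K).
Proof. by move=> x; rewrite /face_scale /subst_u rmorph1 rmorph1 mul1r. Qed.

Fact face_scaleDr n m (B : 'M[int]_(n, m)) (K : simplicial_complex m) :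
  right_distributive (@face_scale n m B K) +%R.
Proof. by move=> f x y; rewrite /face_scale mulrDr. Qed.

Fact face_scaleDl n m (B : 'M[int]_(n, m)) (K : simplicial_complex m)
    (x : face_module B K) :
  {morph (@face_scale n m B K)^~ x : f g / f + g}.
Proof. by move=> f g; rewrite /face_scale /subst_u !rmorphD mulrDl. Qed.

HB.instance Definition _ (n m : nat) (B : 'M[int]_(n, m))
    (K : simplicial_complex m) :=
  GRing.Zmodule_isLmodule.Build {mpoly int[n]} (face_module B K)
    (@face_scaleA n m B K) (@face_scale1 n m B K)
    (@face_scaleDr n m B K) (@face_scaleDl n m B K).

Definition torsion_free (S : idomainType) (M : lmodType S) : Prop :=
  forall (x : M) (s : S), x != 0 -> s != 0 -> s *: x != 0.

(** * Tori *)

(* The homomorphism U(1)^m -> U(1)^n given by B is surjective. *)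
Definition torus_surjective (R : realType) (n m : nat) (B : 'M[int]_(n, m)) :=
  forall r : 'I_n -> complex R, (forall i, `|r i| = 1) ->
    exists2 t : 'I_m -> complex R, (forall j, `|t j| = 1) &
      forall i, r i = \prod_(j < m) t j ^ B i j.

(** * Polytopes *)

Definition dot (R : realType) (d : nat) (u v : 'rV[R]_d) : R :=
  \sum_(i < d) u 0 i * v 0 i.

(* A is nonempty and its affine hull has dimension k: the row space of V is the
   linear span of A - x0. *)
Definition affdim (R : realType) (d : nat) (A : set 'rV[R]_d) (k : nat) :=
  exists2 x0, A x0 & exists V : 'M[R]_d,
    [/\ \rank V = k,
        (forall x, A x -> (x - x0 <= V)%MS) &
        (forall W : 'M[R]_d,
           (forall x, A x -> (x - x0 <= W)%MS) -> (V <= W)%MS)].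

Definition polytope (R : realType) (d : nat) (P : set 'rV[R]_d) :=
  (exists (k : nat) (a : 'I_k -> 'rV[R]_d) (b : 'I_k -> R),
     P = [set x | forall i, dot (a i) x <= b i]) /\
  (exists M : R, forall x, P x -> forall i, `|x 0 i| <= M).

(* The empty set and P itself are faces of P. *)
Definition polytope_face (R : realType) (d : nat) (P F : set 'rV[R]_d) :=
  exists (c : 'rV[R]_d) (a : R),
    (forall x, P x -> dot c x <= a) /\ F = [set x | P x /\ dot c x = a].

Definition polytope_vertex (R : realType) (d : nat) (P : set 'rV[R]_d)
    (v : 'rV[R]_d) :=
  polytope_face P [set v].

Definition polytope_facet (R : realType) (d : nat) (P F : set 'rV[R]_d) :=
  polytope_face P F /\ exists k : nat, affdim P k.+1 /\ affdim F k.

Definition simple_polytope (R : realType) (d n : nat) (P : set 'rV[R]_d) :=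
  [/\ polytope P, affdim P n &
      forall v, polytope_vertex P v ->
        ([set F | polytope_facet P F /\ F v] #= `I_n)%card].

(* Intersecting with P only matters for s empty, where the result is P. *)
Definition facet_inter (R : realType) (d m : nat) (P : set 'rV[R]_d)
    (H : 'I_m -> set 'rV[R]_d) (s : {set 'I_m}) : set 'rV[R]_d :=
  [set x | P x /\ forall i, i \in s -> H i x].

Definition quasi_toric (R : realType) (n m : nat) (B : 'M[int]_(n, m))
    (K : simplicial_complex m) :=
  exists (d : nat) (P : set 'rV[R]_d) (H : 'I_m -> set 'rV[R]_d),
    [/\ simple_polytope n P,
        injective H /\ range H = [set F | polytope_facet P F],
        (forall (v : 'rV[R]_d) (s : {set 'I_m}),
           polytope_vertex P v -> #|s| = n -> facet_inter P H s = [set v] ->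
           basis_of {:'cV[rat]_n}
             [seq col i (map_mx intr B : 'M[rat]_(n, m)) | i <- enum s]) &
        (forall s : {set 'I_m}, s \in K <-> facet_inter P H s !=set0)].

(** * Fans *)

Definition cone_span (R : realType) (n : nat) (I : finType)
    (g : I -> 'rV[R]_n) (s : {set I}) : set 'rV[R]_n :=
  [set x | exists2 c : I -> R, (forall i, 0 <= c i) &
             x = \sum_(i in s) c i *: g i].

Definition simplicial_cone (R : realType) (n : nat) (C : set 'rV[R]_n) :=
  exists (k : nat) (g : 'M[int]_(k, n)),
    let gR : 'M[R]_(k, n) := map_mx intr g in
    row_free gR /\ C = cone_span (fun i => row i gR) [set: 'I_k]%SET.

Definition cone_face (R : realType) (n : nat) (C F : set 'rV[R]_n) :=
  exists u : 'rV[R]_n,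
    (forall x, C x -> 0 <= dot u x) /\ F = [set x | C x /\ dot u x = 0].

Definition simplicial_fan (R : realType) (n : nat) (Sigma : set (set 'rV[R]_n)) :=
  [/\ finite_set Sigma,
      (forall C, Sigma C -> simplicial_cone C),
      (forall C F, Sigma C -> cone_face C F -> Sigma F) &
      (forall C D, Sigma C -> Sigma D ->
         cone_face C (C `&` D) /\ cone_face D (C `&` D))].

Definition complete_fan (R : realType) (n : nat) (Sigma : set (set 'rV[R]_n)) :=
  simplicial_fan Sigma /\ \bigcup_(C in Sigma) C = [set: 'rV[R]_n].

Definition primitive (n : nat) (v : 'rV[int]_n) :=
  forall (k : int) (w : 'rV[int]_n), v = k *: w -> `|k|%N = 1%N.

Definition complete_toric_DM (R : realType) (n m : nat) (B : 'M[int]_(n, m))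
    (K : simplicial_complex m) :=
  exists (Sigma : set (set 'rV[R]_n)) (rho : 'I_m -> set 'rV[R]_n)
         (b : 'I_m -> nat) (beta : 'I_m -> 'rV[int]_n),
    let betaR i : 'rV[R]_n := map_mx intr (beta i) in
    [/\ complete_fan Sigma,
        injective rho /\ range rho = [set C | Sigma C /\ affdim C 1],
        (forall i, [/\ (0 < b i)%N, primitive (beta i) &
                       rho i = cone_span betaR (finset.set1 i)]),
        B = \matrix_(i, j) ((b j)%:Z * beta j 0 i) &
        (forall s : {set 'I_m}, s \in K <-> Sigma (cone_span betaR s))].

(* Main.v *)
Require Import Defs.
From mathcomp Require Import boolp classical_sets cardinality.
From mathcomp Require Import all_boot all_order all_algebra.
From mathcomp Require Import reals mpoly.
From mathcomp Require Import lra.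

(* [Z[K]] is reduced, so it embeds in the product of the polynomial rings
   [Z[x_i : i in s]], [s] a maximal face. If the columns of [B] indexed by [s]
   span [Q^n], then [Z[u]] embeds in the domain [Z[x_i : i in s]]. It therefore
   suffices that every face of [K] extends to a face containing a basis of
   columns.
   For a polytope, a nonempty intersection of facets contains a vertex, and the
   facets through a vertex meet in that vertex only. For a complete fan, a
   generic point close to the sum of the generators of a cone lies in a
   full-dimensional cone, which has the given cone as a face. *)

Set Implicit Arguments.
Unset Strict Implicit.
Unset Printing Implicit Defensive.

Import Order.TTheory GRing.Theory Num.Theory.

Local Open Scope classical_set_scope.
Local Open Scope ring_scope.
Local Open Scope quotient_scope.

(** * Face rings *)

(** Models the projection to the polynomial ring on the variables in [s], but stays inside [{mpoly
    int[m]}], which is a domain and lets different [s] be compared. *)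
Definition restrict (m : nat) (s : {set 'I_m}) (p : {mpoly int[m]})
    : {mpoly int[m]} :=
  p \mPo [tuple if i \in s then 'X_i else 0 | i < m].

Definition mnm_support (m : nat) (u : 'X_{1..m}) : {set 'I_m} :=
  [set i | u i != 0%N].

Lemma restrictM (m : nat) (s : {set 'I_m}) (p q : {mpoly int[m]}) :
  restrict s (p * q) = restrict s p * restrict s q.
Proof. exact: rmorphM. Qed.

Lemma restrictX (m : nat) (s : {set 'I_m}) (u : 'X_{1..m}) :
  restrict s 'X_[u] = if mnm_support u \subset s then 'X_[u] else 0.
Proof.
rewrite /restrict comp_mpolyX; case: ifPn => [us|/subsetPn[i]].
  rewrite [RHS]mpolyXE_id; apply: eq_bigr => i _; rewrite tnth_mktuple.
  have [//|iNs] := ifPn; suff -> : u i = 0%N by rewrite !expr0.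
  by apply/eqP; apply: contraNT iNs => ui; apply: (subsetP us); rewrite inE.
rewrite inE => ui iNs; rewrite (bigD1 i) //= tnth_mktuple (negbTE iNs).
by rewrite expr0n (negbTE ui) mul0r.
Qed.

Lemma comp_mpoly_sum (m k : nat) (lq : m.-tuple {mpoly int[k]})
    (p : {mpoly int[m]}) :
  p \mPo lq = \sum_(u <- msupp p) p@_u *: ('X_[u] \mPo lq).
Proof.
rewrite [p in LHS]mpolyE linear_sum; apply: eq_bigr => u _.
exact: comp_mpolyZ.
Qed.

Lemma comp_mpolyA (m k l : nat) (lq : m.-tuple {mpoly int[k]})
    (lr : k.-tuple {mpoly int[l]}) (p : {mpoly int[m]}) :
  (p \mPo lq) \mPo lr = p \mPo [tuple tnth lq i \mPo lr | i < m].
Proof.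
rewrite [RHS]comp_mpoly_sum [X in X \mPo lr]comp_mpoly_sum.
rewrite (linear_sum (comp_mpoly lr)); apply: eq_bigr => u _ /=.
rewrite comp_mpolyZ !comp_mpolyX rmorph_prod; congr (_ *: _).
by apply: eq_bigr => i _; rewrite rmorphXn tnth_mktuple.
Qed.

(** By [restrictX], restriction deletes the monomials not supported on [s] and fixes the others. *)
Lemma mcoeff_restrict (m : nat) (s : {set 'I_m}) (p : {mpoly int[m]})
    (u : 'X_{1..m}) :
  mnm_support u \subset s -> (restrict s p)@_u = p@_u.
Proof.
move=> us; rewrite [p in RHS]mpolyE /restrict comp_mpoly_sum !raddf_sum /=.
apply: eq_bigr => w _; rewrite !mcoeffZ -/(restrict _ _) restrictX.
case: ifPn => // ws; rewrite mcoeff0 mcoeffX; case: eqP => [wu|//].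
by rewrite wu us in ws.
Qed.

(** A non-face is not contained in the face [s], so its monomial has a variable that restriction
    sends to 0. *)
Lemma restrict_face_ideal (m : nat) (K : simplicial_complex m) (s : {set 'I_m})
    (p : {mpoly int[m]}) :
  s \in K -> p \in face_ideal K -> restrict s p = 0.
Proof.
move=> sK /asboolP[q ->]; rewrite /restrict raddf_sum big1 //= => t tK.
rewrite -/(restrict _ _) restrictM [restrict s (face_monomial t)]rmorph_prod.
have /subsetPn[i it iNs] : ~~ (t \subset s).
  by apply: contra tK => ts; apply: sc_down ts sK.
rewrite (bigD1 i) //= comp_mpolyXU -tnth_nth tnth_mktuple (negbTE iNs).
by rewrite mul0r mulr0.
Qed.

Lemma mpolyX_face_ideal (m : nat) (K : simplicial_complex m) (u : 'X_{1..m}) :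
  mnm_support u \notin K -> 'X_[u] \in face_ideal K.
Proof.
(* [w] is the exponent of the squarefree monomial with the same support as [u]. *)
move=> uK; pose w := [multinom (i \in mnm_support u : nat) | i < m].
have wu : (w <= u)%MM by apply/mnm_lepP => i; rewrite mnmE inE; case: (u i).
suff -> : 'X_[u] = 'X_[u - w] * face_monomial (mnm_support u).
  apply/asboolP; exists (fun t => if t == mnm_support u then 'X_[u - w] else 0).
  rewrite (bigD1 (mnm_support u)) //= eqxx big1 ?addr0 // => t /andP[_].
  by move=> /negbTE->; rewrite mul0r.
rewrite -[in LHS](submK wu) mpolyXD; congr (_ * _).
rewrite mpolyXE_id /face_monomial [RHS]big_mkcond; apply: eq_bigr => i _.
by rewrite mnmE; case: (i \in _).
Qed.

(** If all restrictions to faces vanish, then so does every coefficient of [p] at a monomial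
    supported on a face, and the remaining monomials lie in the ideal. *)
Lemma face_idealP (m : nat) (K : simplicial_complex m) (p : {mpoly int[m]}) :
  p \notin face_ideal K -> exists2 s, s \in K & restrict s p != 0.
Proof.
move=> pK.
have [/existsP[s /andP[sK sp]]|] := boolP [exists s in K, restrict s p != 0].
  by exists s.
rewrite negb_exists => /forallP p0; case/negP: pK.
rewrite (mpolyE p) big_seq; apply: rpred_sum => u; rewrite mcoeff_msupp => pu.
rewrite -mul_mpolyC; apply: idealMr; apply: mpolyX_face_ideal.
apply: contra pu => uK; have := p0 (mnm_support u).
by rewrite uK /= negbK => /eqP pu0; rewrite -(mcoeff_restrict p (subxx _)) pu0 mcoeff0.
Qed.

(** Restriction to [s] factors through restriction to [t]. This allows a face to be enlarged to one
    containing a basis of columns. *)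
Lemma restrict_neq0S (m : nat) (s t : {set 'I_m}) (p : {mpoly int[m]}) :
  s \subset t -> restrict s p != 0 -> restrict t p != 0.
Proof.
move=> st; apply: contra_neq => p0.
have -> : restrict s p = restrict s (restrict t p).
  rewrite /restrict comp_mpolyA; congr (_ \mPo _).
  apply: eq_from_tnth => i; rewrite !tnth_mktuple.
  have [it|iNt] := boolP (i \in t).
    by rewrite comp_mpolyXU -tnth_nth tnth_mktuple.
  by rewrite raddf0 (negbTE (contra (subsetP st i) iNt)).
by rewrite p0 /restrict raddf0.
Qed.

(** * Injectivity of the substitution of the linear forms *)

Lemma comp_scaled_vars_eq0 (n : nat) (D : int) (f : {mpoly int[n]}) :
  D != 0 -> f \mPo [tuple D *: 'X_i | i < n] = 0 -> f = 0.
Proof.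
move=> D0 f0; apply/mpolyP => u; rewrite mcoeff0.
(* The substitution multiplies each coefficient by a power of the nonzero integer [D]. *)
have fX (w : 'X_{1..n}) :
    'X_[w] \mPo [tuple D *: 'X_i | i < n] = D ^+ mdeg w *: 'X_[w] :> {mpoly int[n]}.
  rewrite comp_mpolyX mpolyXE_id mdegE -prodrXr -scaler_prod.
  by apply: eq_bigr => i _; rewrite tnth_mktuple exprZn.
have : (f \mPo [tuple D *: 'X_i | i < n])@_u = D ^+ mdeg u * f@_u.
  rewrite comp_mpoly_sum [f in RHS]mpolyE !raddf_sum mulr_sumr /=.
  apply: eq_bigr => w _; rewrite fX !mcoeffZ mcoeffX.
  by case: eqP => [->|]; rewrite ?mulr1 ?mulr0 // mulrC.
rewrite f0 mcoeff0 => /esym/eqP; rewrite mulf_eq0 expf_eq0 (negbTE D0) andbF /=.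
by move/eqP.
Qed.

(* The adjugate of a nonsingular minor of [B] supported on [s] gives a
   substitution of the [x_j], vanishing off [s], which takes [u_i] to a nonzero
   multiple of a variable. *)
Lemma restrict_subst_u_neq0 (n m : nat) (B : 'M[int]_(n, m)) (s : {set 'I_m})
    (h : 'I_n -> 'I_m) (f : {mpoly int[n]}) :
  (forall k, h k \in s) -> \det (colsub h B) != 0 -> f != 0 ->
  restrict s (subst_u B f) != 0.
Proof.
move=> hs detB; apply: contra_neq => f0.
pose A := \adj (colsub h B).
(* Summing over the fibre of [h] avoids choosing an inverse of [h]. For [j] outside [s] the fibre is
   empty, so restricting to [s] first changes nothing. *)
pose L j : {mpoly int[n]} := \sum_(k | h k == j) \sum_i A k i *: 'X_i.
apply: (comp_scaled_vars_eq0 detB).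
suff <- : restrict s (subst_u B f) \mPo [tuple L j | j < m] =
    f \mPo [tuple \det (colsub h B) *: 'X_i | i < n] by rewrite f0 raddf0.
rewrite /subst_u /restrict !comp_mpolyA; congr (_ \mPo _).
apply: eq_from_tnth => i; rewrite !tnth_mktuple.
rewrite /linear_form !raddf_sum /=.
transitivity (\sum_j B i j *: L j).
  apply: eq_bigr => j _; rewrite !comp_mpolyZ comp_mpolyXU -tnth_nth !tnth_mktuple.
  case: ifPn => [_|js]; first by rewrite comp_mpolyXU -tnth_nth tnth_mktuple.
  rewrite raddf0 /L big_pred0 // => k; apply: contraNF js => /eqP <-; exact: hs.
transitivity (\sum_k B i (h k) *: \sum_l A k l *: ('X_l : {mpoly int[n]})).
  rewrite [RHS](partition_big h predT) //=; apply: eq_bigr => j _.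
  by rewrite /L scaler_sumr; apply: eq_bigr => k /eqP->.
under eq_bigr do rewrite scaler_sumr.
rewrite exchange_big /=.
transitivity (\sum_l (colsub h B *m A) i l *: ('X_l : {mpoly int[n]})).
  apply: eq_bigr => l _; rewrite mxE scaler_suml; apply: eq_bigr => k _.
  by rewrite scalerA !mxE.
rewrite mul_mx_adj (bigD1 i) //= mxE eqxx mulr1n big1 ?addr0 // => l li.
by rewrite mxE eq_sym (negbTE li) mulr0n scale0r.
Qed.

Lemma face_module_torsion_free (n m : nat) (B : 'M[int]_(n, m))
    (K : simplicial_complex m) :
  (forall s, s \in K -> exists2 t, t \in K & s \subset t /\
     exists2 h : 'I_n -> 'I_m, forall k, h k \in t & \det (colsub h B) != 0) ->
  torsion_free (face_module B K : lmodType {mpoly int[n]}).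
Proof.
move=> pureK x f; elim/quotW: x => p.
have piE (q : {mpoly int[m]}) :
    (\pi_({ideal_quot face_ideal K}) q == 0) = (q \in face_ideal K).
  by rewrite -[q in RHS]subr0 Quotient.idealrBE pi_zeror.
rewrite -[_ == 0]/(\pi_({ideal_quot face_ideal K}) p == 0) piE => pK f0.
have -> : f *: (\pi_({ideal_quot face_ideal K}) p : face_module B K)
  = \pi_({ideal_quot face_ideal K}) (subst_u B f * p).
  by rewrite rmorphM.
rewrite -[_ == 0]/(\pi_({ideal_quot face_ideal K}) (subst_u B f * p) == 0) piE.
(* After restriction to [t], both factors are nonzero elements of a domain. *)
have [s sK sp] := face_idealP pK.
have [t tK [st [h ht hB]]] := pureK s sK.
apply: contraNN (restrict_neq0S st sp) => fpK.
have := restrict_face_ideal tK fpK; rewrite restrictM => /eqP.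
by rewrite mulf_eq0 (negbTE (restrict_subst_u_neq0 ht hB f0)).
Qed.

(** * Polytopes *)

(** Takes the minimum of finitely many thresholds, so that one small parameter serves all
    conditions. *)
Lemma eventually_seq (R : realType) (T : eqType) (s : seq T) (Q : T -> R -> Prop) :
  (forall x, x \in s -> exists2 e, 0 < e & forall t, 0 < t <= e -> Q x t) ->
  exists2 e, 0 < e & forall t, 0 < t <= e -> forall x, x \in s -> Q x t.
Proof.
elim: s => [|x s IH] sQ; first by exists 1.
have [e1 e1_gt0 Qe1] := sQ x (mem_head _ _).
have [|e2 e2_gt0 Qe2] := IH; first by move=> y ys; apply: sQ; rewrite inE ys orbT.
exists (Num.min e1 e2) => [|t]; first by rewrite lt_min e1_gt0.
rewrite le_min => /and3P[t0 te1 te2] y; rewrite inE => /predU1P[->|].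
  by apply: Qe1; rewrite t0.
by apply: Qe2; rewrite t0.
Qed.

(** * Inner products and half-spaces *)

Lemma dot_mx (R : realType) (d : nat) (u v : 'rV[R]_d) :
  dot u v = (v *m u^T) 0 0.
Proof. by rewrite mxE; apply: eq_bigr => i _; rewrite mxE mulrC. Qed.

Lemma dotDr (R : realType) (d : nat) (u v w : 'rV[R]_d) :
  dot u (v + w) = dot u v + dot u w.
Proof. by rewrite !dot_mx mulmxDl mxE. Qed.

Lemma dotZr (R : realType) (d : nat) (u v : 'rV[R]_d) (c : R) :
  dot u (c *: v) = c * dot u v.
Proof. by rewrite !dot_mx -scalemxAl mxE. Qed.

Lemma dotBr (R : realType) (d : nat) (u v w : 'rV[R]_d) :
  dot u (v - w) = dot u v - dot u w.
Proof. by rewrite !dot_mx mulmxBl !mxE. Qed.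

Lemma dot_suml (R : realType) (d : nat) (I : finType) (s : pred I)
    (c : I -> 'rV[R]_d) (v : 'rV[R]_d) :
  dot (\sum_(i | s i) c i) v = \sum_(i | s i) dot (c i) v.
Proof.
rewrite /dot exchange_big; apply: eq_bigr => i _.
by rewrite summxE mulr_suml.
Qed.

Lemma dot_sumr (R : realType) (d : nat) (I : finType) (s : pred I)
    (c : I -> 'rV[R]_d) (v : 'rV[R]_d) :
  dot v (\sum_(i | s i) c i) = \sum_(i | s i) dot v (c i).
Proof.
rewrite /dot exchange_big; apply: eq_bigr => i _.
by rewrite summxE mulr_sumr.
Qed.

Lemma sub_ker_dot (R : realType) (d : nat) (u v : 'rV[R]_d) :
  (v <= kermx u^T)%MS = (dot u v == 0).
Proof.
rewrite dot_mx; apply/sub_kermxP/eqP => [->|vu]; first by rewrite mxE.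
by apply/matrixP => i j; rewrite !ord1 vu mxE.
Qed.

Lemma halfspaces_step (R : realType) (d k : nat) (a : 'I_k -> 'rV[R]_d)
    (b : 'I_k -> R) (J : pred 'I_k) (z w : 'rV[R]_d) :
  (forall j, J j -> dot (a j) z < b j) ->
  exists2 e, 0 < e & forall j, J j -> dot (a j) (z + e *: w) <= b j.
Proof.
move=> Jz.
have [|e e0 He] := @eventually_seq R _ (enum 'I_k)
    (fun j t => J j -> dot (a j) (z + t *: w) <= b j).
  move=> j _; have [Jj|] := boolP (J j); last by exists 1.
  have := Jz j Jj; rewrite -subr_gt0 => gap; set g := _ - _ in gap.
  (* The summand 1 keeps [q] positive when [w] is orthogonal to [a j]. *)
  pose q := `|dot (a j) w| + 1.
  have q0 : 0 < q by rewrite ltr_wpDl.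
  exists (g / q) => [|t /andP[t0 tg] _]; first by rewrite divr_gt0.
  rewrite dotDr dotZr -lerBrDl -/g.
  apply: le_trans (ler_wpM2l (ltW t0) (ler_norm _)) _.
  apply: le_trans (_ : t * q <= _); first by rewrite ler_wpM2l ?ltW ?ltrDl.
  by rewrite -ler_pdivlMr.
exists e => // j Jj; apply: He => //; first by rewrite e0 lexx.
by rewrite mem_enum.
Qed.

Lemma polytope_strict_point (R : realType) (d k : nat) (P : set 'rV[R]_d)
    (a : 'I_k -> 'rV[R]_d) (b : 'I_k -> R) (J : {set 'I_k}) (x0 : 'rV[R]_d) :
  (forall x, P x <-> forall i, dot (a i) x <= b i) -> P x0 ->
  (forall j, j \in J -> exists2 y, P y & dot (a j) y < b j) ->
  exists2 z, P z & forall j, j \in J -> dot (a j) z < b j.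
Proof.
move=> PE Px0 HJ.
suff [z Pz Hz] : exists2 z, P z & forall j, j \in enum J -> dot (a j) z < b j.
  by exists z => // j jJ; apply: Hz; rewrite mem_enum.
have : forall j, j \in enum J -> exists2 y, P y & dot (a j) y < b j.
  by move=> j; rewrite mem_enum => /HJ.
elim: (enum J) => [|j s IH] Hs; first by exists x0.
have [|z Pz zs] := IH; first by move=> i si; apply: Hs; rewrite inE si orbT.
have [y Py yj] := Hs j (mem_head _ _).
(* An inequality strict at either endpoint is strict at the midpoint. *)
exists (2^-1 *: (z + y)).
  apply/PE => i; have /PE/(_ i) := Pz; have /PE/(_ i) := Py.
  by rewrite dotZr dotDr; lra.
move=> i; rewrite inE dotZr dotDr => /predU1P[->|/zs].
  by have /PE/(_ j) := Pz; lra.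
by have /PE/(_ i) := Py; lra.
Qed.

(** The segment from [z], strict for all of [J], to [y], violating only inequality [i], meets the
    hyperplane of [i] at a point [p] where the other inequalities of [J] are strict. Near [p] the
    face fills that hyperplane within the affine hull of [P]. *)
Lemma irredundant_facet (R : realType) (d k n : nat) (P : set 'rV[R]_d)
    (a : 'I_k -> 'rV[R]_d) (b : 'I_k -> R) (J : {set 'I_k}) (i : 'I_k)
    (x0 y z : 'rV[R]_d) (V : 'M[R]_d) :
  (forall x, P x <-> forall i, dot (a i) x <= b i) ->
  affdim P n -> \rank V = n ->
  (forall x, P x -> (x - x0 <= V)%MS) ->
  (forall x, (x - x0 <= V)%MS ->
     (forall j, j \in J -> dot (a j) x <= b j) -> P x) ->
  P z -> (forall j, j \in J -> dot (a j) z < b j) ->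
  (y - x0 <= V)%MS -> i \in J -> b i < dot (a i) y ->
  (forall j, j \in J -> j != i -> dot (a j) y <= b j) ->
  polytope_facet P [set x | P x /\ dot (a i) x = b i].
Proof.
move=> PE dimP rV PV PJ Pz zJ yV iJ yi yJ.
have Pai x : P x -> dot (a i) x <= b i by move=> /PE/(_ i).
split; first by exists (a i), (b i); split => // x /Pai.
have zi := zJ i iJ.
pose t := (b i - dot (a i) z) / (dot (a i) y - dot (a i) z).
have gap : 0 < dot (a i) y - dot (a i) z by rewrite subr_gt0 (lt_trans zi).
have t0 : 0 < t by rewrite divr_gt0 // subr_gt0.
have t1 : t < 1 by rewrite ltr_pdivrMr // mul1r ltrD2r.
pose p := z + t *: (y - z).
have pi : dot (a i) p = b i.
  by rewrite dotDr dotZr dotBr divfK ?subrKC // gt_eqF.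
have zyV : (y - z <= V)%MS.
  have -> : y - z = (y - x0) - (z - x0) by rewrite opprB addrA subrK.
  by rewrite addmx_sub ?eqmx_opp // PV.
have pV : (p - x0 <= V)%MS.
  by rewrite /p addrAC addmx_sub ?scalemx_sub // PV.
have pJ j : j \in J -> j != i -> dot (a j) p < b j.
  move=> jJ ji; have := zJ j jJ; have := yJ j jJ ji.
  by rewrite dotDr dotZr dotBr => yj zj; nra.
have Pp : P p.
  apply: PJ => // j jJ; have [->|ji] := eqVneq j i; first by rewrite pi.
  exact/ltW/pJ.
(* The rank drops by exactly one because [a i] is nonzero on the direction [y - z] of [V]. *)
have rW : \rank V = (\rank (V :&: kermx (a i)^T)%MS).+1.
  rewrite -(mxrank_mul_ker V (a i)^T) -[RHS]add1n; congr (_ + _)%N; apply/eqP.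
  rewrite eqn_leq rank_leq_col lt0n mxrank_eq0; apply: contraTneq gap => Va0.
  have /submxP[D yzD] := zyV.
  by rewrite -dotBr dot_mx yzD -mulmxA Va0 mulmx0 mxE ltxx.
exists (\rank (V :&: kermx (a i)^T)%MS); split; first by rewrite -rW rV.
exists p => //; exists (V :&: kermx (a i)^T)%MS; split => // [x [Px xi]|W HW].
  rewrite sub_capmx sub_ker_dot dotBr xi pi subrr eqxx andbT.
  have -> : x - p = (x - x0) - (p - x0) by rewrite opprB addrA subrK.
  by rewrite addmx_sub ?eqmx_opp // PV.
apply/row_subP => l; have := row_sub l (V :&: kermx (a i)^T)%MS.
move: (row l _) => w; rewrite sub_capmx sub_ker_dot => /andP[wV /eqP aw].
(* A short step from [p] along [w] stays in the face, which forces [w] into [W]. *)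
have [e e0 pe] : exists2 e, 0 < e &
    forall j, (j \in J) && (j != i) -> dot (a j) (p + e *: w) <= b j.
  by apply: halfspaces_step => j /andP[]; exact: pJ.
have : (e *: w <= W)%MS.
  rewrite -[e *: w](addKr p) addrC; apply: HW => /=; split.
    apply: PJ => [|j jJ]; first by rewrite addrAC addmx_sub ?scalemx_sub.
    have [->|ji] := eqVneq j i; first by rewrite dotDr dotZr aw mulr0 addr0 pi.
    by apply: pe; rewrite jJ.
  by rewrite dotDr dotZr aw mulr0 addr0 pi.
by move=> /(scalemx_sub e^-1); rewrite scalerA mulVf ?scale1r // gt_eqF.
Qed.

(* In a minimal system of inequalities describing [P] inside its affine hull,
   every inequality defines a facet; if all facets through the vertex [v]
   contain [x], the segment from [x] to [v] can be prolonged beyond [v]. *)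
Lemma vertex_facet_separation (R : realType) (d n : nat) (P : set 'rV[R]_d)
    (v x : 'rV[R]_d) :
  polytope P -> affdim P n -> polytope_vertex P v -> P x ->
  (forall F, polytope_facet P F -> F v -> F x) -> x = v.
Proof.
move=> [[k [a [b PE']]] _] dimP [c [al [Pc vE]]] Px Fx.
have PE x' : P x' <-> forall i, dot (a i) x' <= b i by rewrite PE'.
have [x0 Px0 [V [rV PV minV]]] := dimP.
pose Q (J : {set 'I_k}) := `[< forall x, (x - x0 <= V)%MS ->
     (forall j, j \in J -> dot (a j) x <= b j) -> P x >].
have QT : Q setT by apply/asboolP => y _ yT; apply/PE => i; apply: yT; rewrite inE.
have [J /minsetP[/asboolP QJ minJ] _] := minset_exists QT.
have irr i : i \in J -> exists y, [/\ (y - x0 <= V)%MS, b i < dot (a i) y &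
    forall j, j \in J -> j != i -> dot (a j) y <= b j].
  move=> iJ; have /asboolP : ~~ Q (J :\ i)%SET.
    apply/negP => QJi; have := minJ _ QJi (subsetDl _ _).
    by move=> /setP/(_ i); rewrite !inE eqxx iJ.
  move=> /existsNP[y /not_implyP[yV /not_implyP[yJ Py]]].
  have yJi j : j \in J -> j != i -> dot (a j) y <= b j.
    by move=> jJ ji; apply: yJ; rewrite !inE ji.
  exists y; split => //; rewrite ltNge; apply/negP => yi; apply: Py; apply: QJ => // j jJ.
  by have [->|ji] := eqVneq j i; [|exact: yJi].
(* An inequality of [J] tight on all of [P] would be tight on the affine hull, yet irredundancy
   gives a point of the hull violating it. *)
have [z Pz zJ] : exists2 z, P z & forall j, j \in J -> dot (a j) z < b j.
  apply: (polytope_strict_point PE Px0) => j jJ; apply: contrapT => noy.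
  have Pj y : P y -> dot (a j) y = b j.
    move=> Py; apply/eqP; rewrite eq_le (PE y).1 //= leNgt; apply/negP => yj.
    by apply: noy; exists y.
  have [y [yV yj _]] := irr j jJ.
  have /submx_trans/(_ (minV (kermx (a j)^T) _)) := yV.
  rewrite sub_ker_dot dotBr (Pj x0) // subr_eq0 => yb.
  have {}/yb : forall x', P x' -> (x' - x0 <= kermx (a j)^T)%MS.
    by move=> x' Px'; rewrite sub_ker_dot dotBr !Pj // subrr.
  by move=> /eqP yb; rewrite yb ltxx in yj.
have Pv : P v /\ dot c v = al by have : [set v] v by []; rewrite vE.
have [Pv1 cv] := Pv.
have xV : (v - x <= V)%MS.
  have -> : v - x = (v - x0) - (x - x0) by rewrite opprB addrA subrK.
  by rewrite addmx_sub ?eqmx_opp // PV.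
have [e e0 ve] : exists2 e, 0 < e & forall j, dot (a j) v < b j ->
    dot (a j) (v + e *: (v - x)) <= b j.
  exact: halfspaces_step.
(* An inequality of [J] tight at [v] defines a facet through [v], hence is tight at [x] and along
   the whole line; the others have slack at [v]. *)
have Pe : P (v + e *: (v - x)).
  apply: (QJ) => [|j jJ]; first by rewrite addrAC addmx_sub ?scalemx_sub // PV.
  have := (PE v).1 Pv1 j; rewrite le_eqVlt => /predU1P[vj|]; last exact: ve.
  have [y [yV yj yJ]] := irr j jJ.
  have [_ xj] := Fx _ (irredundant_facet PE dimP rV PV QJ Pz zJ yV jJ yj yJ) (conj Pv1 vj).
  by rewrite dotDr dotZr dotBr vj xj subrr mulr0 addr0.
(* If [c] were smaller at [x] than at [v], it would exceed its maximum at the prolonged point. *)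
have cx : dot c x = al.
  apply/eqP; rewrite eq_le Pc //=.
  have := Pc _ Pe; rewrite dotDr dotZr dotBr cv gerDl pmulr_rle0 //.
  by rewrite subr_le0.
by have : [set v] x by rewrite vE.
Qed.

(** Induction on the number of inequalities that are not tight at [x]. If the tight ones do not
    determine [x] within [P], moving along a direction that preserves them makes a further one
    tight. *)
Lemma polytope_face_vertex (R : realType) (d : nat) (P : set 'rV[R]_d)
    (c : 'rV[R]_d) (al : R) (x : 'rV[R]_d) :
  polytope P -> (forall x, P x -> dot c x <= al) -> P x -> dot c x = al ->
  exists2 v, polytope_vertex P v & dot c v = al.
Proof.
move=> [[k [a [b PE']]] [M PM]] Pc.
have PE x' : P x' <-> forall i, dot (a i) x' <= b i by rewrite PE'.
pose act x : {set 'I_k} := [set i | dot (a i) x == b i]%SET.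
have [N] := ubnP (k - #|act x|)%N; elim: N x => // N IH x actN Px cx.
have [[y [Py [yx /eqP yNx]]]|noy] :=
  pselect (exists y, P y /\ (forall i, i \in act x -> dot (a i) y = b i) /\ y <> x);
  last first.
  (* The sum of the tight inequalities supports [P], and equality in the sum forces equality in
     each. *)
  exists x => //; exists (\sum_(i in act x) a i), (\sum_(i in act x) b i); split.
    by move=> y /PE Py; rewrite dot_suml ler_sum.
  apply/seteqP; split => y /= => [->|[Py yact]].
    split=> //; rewrite dot_suml; apply: eq_bigr => i.
    by rewrite inE => /eqP.
  apply: contrapT => yNx; apply: noy; exists y; split => //; split => // i ix.
  have : \sum_(i in act x) (b i - dot (a i) y) = 0.
    by rewrite sumrB -dot_suml yact subrr.
  move=> /psumr_eq0P H; apply/esym/eqP; rewrite -subr_eq0; apply/eqP; apply: H ix.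
  by move=> j _; rewrite subr_ge0; exact: (PE y).1.
pose w := y - x.
have w_act i : i \in act x -> dot (a i) w = 0.
  by move=> ix; rewrite dotBr yx //; move: ix; rewrite inE => /eqP->; rewrite subrr.
(* [P] contains [y] and also a point slightly behind [x], so [c] can neither increase nor decrease
   along [w]. *)
have cw : dot c w = 0.
  have cw_le0 : dot c w <= 0 by rewrite dotBr cx subr_le0 Pc.
  apply/eqP; rewrite eq_le cw_le0 /=.
  have [e e0 xe] : exists2 e, 0 < e & forall j, j \notin act x ->
      dot (a j) (x + e *: - w) <= b j.
    apply: halfspaces_step => j; rewrite inE => xj.
    by rewrite lt_neqAle xj (PE x).1.
  have /Pc : P (x + e *: - w).
    apply/PE => j; have [jx|/xe//] := boolP (j \in act x).
    rewrite scalerN -scaleNr dotDr dotZr w_act // mulr0 addr0; exact: (PE x).1.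
  by rewrite scalerN -scaleNr dotDr dotZr cx gerDl mulNr oppr_le0 pmulr_rge0.
pose E := [pred i | 0 < dot (a i) w].
(* Otherwise the whole ray from [x] along [w] lies in [P], against boundedness. *)
have [i0 i0E] : exists i0, E i0.
  apply: contrapT => noE.
  have wE i : dot (a i) w <= 0.
    by rewrite leNgt; apply/negP => wi; apply: noE; exists i.
  have Pxw t : 0 <= t -> P (x + t *: w).
    move=> t0; apply/PE => i; rewrite dotDr dotZr.
    by have := (PE x).1 Px i; have := wE i; nra.
  have [j wj] : exists j, w 0 j != 0.
    apply: contrapT => now; move: yNx; rewrite -subr_eq0 -/w => /eqP; apply.
    apply/rowP => j; rewrite [RHS]mxE; apply/eqP; apply: contrapT => wj; apply: now.
    by exists j; apply/negP.
  have w0 : 0 < `|w 0 j| by rewrite normr_gt0.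
  (* Chosen so that coordinate [j] of [x + t *: w] has absolute value at least [|M| + 1]. *)
  pose t := (`|M| + 1 + `|x 0 j|) / `|w 0 j|.
  have t0 : 0 <= t by rewrite divr_ge0 // !addr_ge0.
  have := PM _ (Pxw t t0) j; rewrite mxE addrC [(t *: w) _ _]mxE leNgt.
  move=> /negP; apply.
  have : `|t * w 0 j| = `|M| + 1 + `|x 0 j|.
    by rewrite normrM ger0_norm // divfK ?gt_eqF.
  have := lerB_normD (t * w 0 j) (x 0 j); have := ler_norm M.
  by lra.
(* The time at which inequality [i] becomes tight; the least one gives the point where the ray
   leaves [P]. *)
pose r i := (b i - dot (a i) x) / dot (a i) w.
case: (arg_minP r i0E) => i iE imin.
have r0 : 0 <= r i by rewrite divr_ge0 ?subr_ge0 ?(PE x).1 // ltW.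
have Px' : P (x + r i *: w).
  apply/PE => j; rewrite dotDr dotZr; have xj := (PE x).1 Px j.
  have [wj|wj] := ltP 0 (dot (a j) w).
    by have := imin j wj; rewrite {2}/r ler_pdivlMr // => ?; lra.
  by nra.
apply: (IH (x + r i *: w)) => //; last by rewrite dotDr dotZr cx cw mulr0 addr0.
rewrite -ltnS; apply: leq_trans actN; rewrite ltnS; apply: ltn_sub2l.
  rewrite -[X in (_ < X)%N]card_ord -cardsT; apply: proper_card; rewrite properE subsetT.
  apply/subsetPn; exists i => //; apply: contraTN iE => ix.
  by rewrite /= w_act // ltxx.
apply: proper_card; rewrite properE; apply/andP; split.
  apply/subsetP => j jx; rewrite inE dotDr dotZr w_act // mulr0 addr0.
  by move: jx; rewrite inE.
apply/subsetPn; exists i; last by apply: contraTN iE => ix; rewrite /= w_act // ltxx.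
by rewrite inE dotDr dotZr divfK ?subrKC // gt_eqF.
Qed.

(** * Facets through a vertex and the columns they index *)

Lemma basis_col_det (n m : nat) (B : 'M[int]_(n, m)) (s : {set 'I_m})
    (cs : #|s| = n) (h := fun k : 'I_n => enum_val (cast_ord (esym cs) k)) :
  basis_of {:'cV[rat]_n}
    [seq col i (map_mx intr B : 'M[rat]_(n, m)) | i <- enum s] ->
  \det (colsub h B) != 0.
Proof.
move=> /basis_free; set X := [seq _ | _ <- _] => freeX.
have sX : size X == n by rewrite size_map -cardE cs.
have XE (k : 'I_n) : X`_k = col (h k) (map_mx intr B).
  have hE : h k = nth (h k) (enum s) k.
    exact: (enum_val_nth (h k) (cast_ord (esym cs) k)).
  by rewrite (nth_map (h k)) -?hE // -cardE cs.
apply/negP => /eqP det0.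
(* A kernel vector of the transposed minor is a linear relation between the columns. *)
have /det0P[v v0 vB] : \det (map_mx intr (colsub h B) : 'M[rat]_n)^T == 0.
  by rewrite det_tr det_map_mx det0.
have v_eq0 := @freeP _ _ _ (Tuple sX) freeX (fun k => v 0 k).
move/eqP: v0; apply; apply/rowP => k; rewrite [RHS]mxE; apply: v_eq0.
apply/colP => i; rewrite summxE [RHS]mxE.
transitivity ((v *m (map_mx intr (colsub h B))^T) 0 i); last by rewrite vB mxE.
by rewrite [RHS]mxE; apply: eq_bigr => j _; rewrite XE !mxE.
Qed.

Lemma card_facet_indices (R : realType) (d m n : nat) (P : set 'rV[R]_d)
    (H : 'I_m -> set 'rV[R]_d) (v : 'rV[R]_d) :
  injective H -> range H = [set F | polytope_facet P F] ->
  ([set F | polytope_facet P F /\ F v] #= `I_n)%card ->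
  #|[set i | `[< H i v >]]%SET| = n.
Proof.
move=> injH rangeH; set s := [set i | _]%SET => cardF.
pose T := [seq H i | i <- enum s]; pose f k := nth classical_sets.set0 T k.
have sT : size T = #|s| by rewrite size_map -cardE.
have uT : uniq T by rewrite map_inj_uniq ?enum_uniq.
have fT : f @` `I_#|s| = [set F | polytope_facet P F /\ F v].
  apply/seteqP; split => [_ [k /= ks <-]|F /= [FP Fv]].
    have /mapP[i] : f k \in T by rewrite mem_nth ?sT.
    rewrite mem_enum inE => /asboolP Hv ->; split => //.
    suff : [set F | polytope_facet P F] (H i) by [].
  by rewrite -rangeH; exists i.
  have [i _ HF] : range H F by rewrite rangeH.
  have FT : F \in T.
    by apply/mapP; exists i => //; rewrite mem_enum inE; apply/asboolP; rewrite HF.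
  have ltT : (index F T < #|s|)%N by rewrite -sT index_mem.
  by exists (index F T); rewrite // /f nth_index.
apply/esym/card_eq_II; apply: card_eq_trans (card_esym cardF) _; rewrite -fT.
apply: inj_card_eq => k l /set_mem ks /set_mem ls /eqP.
by rewrite nth_uniq ?sT // => /eqP.
Qed.

Lemma polytope_vertex_mem (R : realType) (d : nat) (P : set 'rV[R]_d)
    (v : 'rV[R]_d) :
  polytope_vertex P v -> P v.
Proof.
by move=> [c [al [_ vE]]]; have : [set v] v by []; rewrite vE => -[].
Qed.

Lemma quasi_toric_bases (R : realType) (n m : nat) (B : 'M[int]_(n, m))
    (K : simplicial_complex m) :
  quasi_toric R B K ->
  forall s, s \in K -> exists2 t, t \in K & s \subset t /\
     exists2 h : 'I_n -> 'I_m, forall k, h k \in t & \det (colsub h B) != 0.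
Proof.
move=> [d [P [H [[polyP dimP simpleP] [injH rangeH] basisP KE]]]] s /KE[x [Px xs]].
have facetH i : polytope_facet P (H i).
  suff : [set F | polytope_facet P F] (H i) by [].
  by rewrite -rangeH; exists i.
have /choice[ca caP] : forall i, exists ca : 'rV[R]_d * R,
    (forall x, P x -> dot ca.1 x <= ca.2) /\
    H i = [set x | P x /\ dot ca.1 x = ca.2].
  by move=> i; have [[c [al Hi]] _] := facetH i; exists (c, al).
(* Summing the supporting functionals of the facets in [s] exhibits their intersection as a face,
   attained at [x]. *)
have sumP y : P y ->
    dot (\sum_(i in s) (ca i).1) y <= \sum_(i in s) (ca i).2.
  by move=> Py; rewrite dot_suml; apply: ler_sum => i _; apply: (caP i).1.
have [v vv vs] : exists2 v, polytope_vertex P v &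
    dot (\sum_(i in s) (ca i).1) v = \sum_(i in s) (ca i).2.
  apply: (polytope_face_vertex polyP sumP Px); rewrite dot_suml.
  apply: eq_bigr => i si; have := xs i si; rewrite (caP i).2.
  by move=> [].
have Pv := polytope_vertex_mem vv.
pose t := [set i | `[< H i v >]]%SET.
have tE i : (i \in t) <-> H i v by rewrite inE; split => /asboolP.
have tcard : #|t| = n by apply: card_facet_indices (simpleP v vv).
have st : s \subset t.
  apply/subsetP => i si; apply/tE; rewrite (caP i).2 /=; split => //.
  have : \sum_(i in s) ((ca i).2 - dot (ca i).1 v) = 0.
    by rewrite sumrB -dot_suml vs subrr.
  move=> /psumr_eq0P H0; apply/esym/eqP; rewrite -subr_eq0; apply/eqP.
  by apply: H0 si => j _; rewrite subr_ge0; apply: (caP j).1.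
(* This is what makes the basis hypothesis applicable to [t]. *)
have tv : facet_inter P H t = [set v].
  apply/seteqP; split => [y [Py yt]|_ ->] /=; last first.
    by split => // i /tE.
  apply: (vertex_facet_separation polyP dimP vv Py) => F PF Fv.
  have [i _ HF] : range H F by rewrite rangeH.
  by rewrite -HF; apply: yt; apply/tE; rewrite HF.
exists t; first by apply/KE; rewrite tv; exists v.
split => //; exists (fun k => enum_val (cast_ord (esym tcard) k)).
  by move=> k; exact: enum_valP.
by apply: basis_col_det; apply: (basisP v).
Qed.

(** * Complete fans *)

(** Positive roots are split off one at a time, keeping [t] below half of each. *)
Lemma poly_eventually_neq0 (R : realFieldType) (p : {poly R}) :
  p != 0 -> exists2 e, 0 < e & forall t, 0 < t <= e -> p.[t] != 0.
Proof.
have [N] := ubnP (size p); elim: N p => // N IH p pN p0.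
have [[r r0 /factor_theorem[q pE]]|nor] := pselect (exists2 r, 0 < r & root p r).
  have q0 : q != 0 by apply: contraNneq p0 => q0; rewrite pE q0 mul0r.
  have [|e e0 qe] := IH q _ q0.
    by move: pN; rewrite pE size_Mmonic ?monicXsubC // size_XsubC addn2.
  exists (Num.min e (r / 2)) => [|t]; first by rewrite lt_min e0 divr_gt0.
  rewrite le_min => /and3P[t0 te tr]; rewrite pE hornerM mulf_neq0 ?qe ?t0 //.
  by rewrite hornerXsubC subr_eq0 lt_eqF // (le_lt_trans tr) //; lra.
exists 1 => // t /andP[t0 _]; apply/negP => pt; apply: nor.
by exists t.
Qed.

(** A sign change after 0 would produce a root in an interval free of roots. *)
Lemma poly_eventually_lt0 (R : rcfType) (p : {poly R}) :
  p.[0] < 0 -> exists2 e, 0 < e & forall t, 0 < t <= e -> p.[t] < 0.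
Proof.
move=> p0; have pN0 : p != 0.
  by apply: contraTneq p0 => ->; rewrite horner0 ltxx.
have [e e0 pe] := poly_eventually_neq0 pN0; exists e => // t /andP[t0 te].
rewrite ltNge; apply/negP => pt.
have [||r /andP[r0 rt] pr] := @poly_ivt _ p 0 t; [exact: ltW|by rewrite (ltW p0)|].
have rN0 : r != 0 by apply: contraTneq p0 => r_0; move/eqP: pr; rewrite r_0 => ->; rewrite ltxx.
have := pe r; rewrite lt_neqAle eq_sym rN0 r0 (le_trans rt te) => /(_ isT).
by rewrite (eqP pr) eqxx.
Qed.

(** The exponents start at 1: the curve passes through the origin at [t = 0], and the constant
    coefficient is left for [dot u x] in [dot_poly]. *)
Definition moment_curve (R : realType) (n : nat) (t : R) : 'rV[R]_n :=
  \row_(j < n) t ^+ j.+1.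

Definition dot_poly (R : realType) (n : nat) (u x : 'rV[R]_n) : {poly R} :=
  \poly_(i < n.+1) oapp (u 0) (dot u x) (unlift ord0 (inord i)).

Lemma dot_poly_coef (R : realType) (n : nat) (u x : 'rV[R]_n) (j : 'I_n) :
  (dot_poly u x)`_j.+1 = u 0 j.
Proof.
rewrite coef_poly ltnS ltn_ord.
have -> : inord j.+1 = lift ord0 j by apply/val_inj; rewrite /= inordK ?ltnS.
by rewrite liftK.
Qed.

Lemma dot_polyE (R : realType) (n : nat) (u x : 'rV[R]_n) (t : R) :
  (dot_poly u x).[t] = dot u (x + moment_curve n t).
Proof.
rewrite /dot_poly horner_poly big_ord_recl dotDr; congr (_ + _).
  by rewrite (_ : inord _ = ord0) ?unlift_none ?mulr1 //; apply/val_inj; rewrite /= inordK.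
apply: eq_bigr => j _; rewrite (_ : inord _ = lift ord0 j); last first.
  by apply/val_inj; rewrite /= inordK ?ltnS.
by rewrite liftK mxE.
Qed.

(** The entries of [u] are coefficients of [dot_poly u x], so this polynomial is nonzero even when
    [x] lies on the hyperplane. *)
Lemma moment_curve_avoids_hyperplane (R : realType) (n : nat) (u x : 'rV[R]_n) :
  u != 0 ->
  exists2 e, 0 < e & forall t, 0 < t <= e -> dot u (x + moment_curve n t) != 0.
Proof.
move=> u0; have [|e e0 He] := @poly_eventually_neq0 R (dot_poly u x).
  apply: contraNneq u0 => p0; apply/eqP/rowP => j.
  by rewrite -(dot_poly_coef u x) p0 coef0 mxE.
by exists e => // t /He; rewrite dot_polyE.
Qed.

Lemma moment_curve_lt0 (R : realType) (n : nat) (u x : 'rV[R]_n) :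
  dot u x < 0 ->
  exists2 e, 0 < e & forall t, 0 < t <= e -> dot u (x + moment_curve n t) < 0.
Proof.
move=> ux; have [|e e0 He] := @poly_eventually_lt0 R (dot_poly u x).
  rewrite dot_polyE (_ : moment_curve n 0 = 0) ?addr0 //.
  by apply/rowP => j; rewrite !mxE expr0n.
by exists e => // t /He; rewrite dot_polyE.
Qed.

(** * Simplicial cones in coordinates *)

Lemma cone_span_rowsP (R : realType) (k n : nat) (G : 'M[R]_(k, n))
    (y : 'rV[R]_n) :
  cone_span (fun i => row i G) [set: 'I_k]%SET y <->
  exists2 c : 'rV[R]_k, (forall i, 0 <= c 0 i) & y = c *m G.
Proof.
split=> [[c c0 ->]|[c c0 ->]].
  exists (\row_i c i) => [i|]; first by rewrite mxE.
  rewrite mulmx_sum_row; apply: eq_big => [i|i _]; first by rewrite inE.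
  by rewrite mxE.
exists (fun i => c 0 i) => //; rewrite mulmx_sum_row.
by apply: eq_bigl => i; rewrite inE.
Qed.

Lemma full_cone_spanP (R : realType) (n : nat) (G : 'M[R]_n) (y : 'rV[R]_n) :
  G \in unitmx ->
  cone_span (fun i => row i G) [set: 'I_n]%SET y <->
  forall i, 0 <= (y *m invmx G) 0 i.
Proof.
move=> uG; rewrite cone_span_rowsP; split=> [[c c0 ->] i|yc].
  by rewrite mulmxK.
by exists (y *m invmx G) => //; rewrite mulmxKV.
Qed.

Lemma small_cone_hyperplane (R : realType) (k n : nat) (G : 'M[R]_(k, n)) :
  (k < n)%N -> exists2 u : 'rV[R]_n, u != 0 &
    forall y, cone_span (fun i => row i G) [set: 'I_k]%SET y -> dot u y = 0.
Proof.
move=> kn; have /rowV0Pn[u uG u0] : kermx G^T != 0.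
  rewrite -mxrank_eq0 mxrank_ker subn_eq0 -ltnNge.
  exact: leq_ltn_trans (rank_leq_col _) kn.
exists u => // y /cone_span_rowsP[c _ ->].
rewrite dot_mx -mulmxA -[G]trmxK -trmx_mul.
by move/sub_kermxP: uG => ->; rewrite trmx0 mulmx0 mxE.
Qed.

(* The points [x + (t, ..., t^n)] with [t > 0] small avoid every cone of lower
   dimension and every full-dimensional cone which does not contain [x]. *)
Lemma complete_fan_full_cone (R : realType) (n : nat)
    (Sigma : set (set 'rV[R]_n)) (x : 'rV[R]_n) :
  complete_fan Sigma ->
  exists2 g : 'M[int]_n, (map_mx intr g : 'M[R]_n) \in unitmx &
    Sigma (cone_span (fun i => row i (map_mx intr g : 'M[R]_n)) [set: 'I_n]%SET) /\
    cone_span (fun i => row i (map_mx intr g : 'M[R]_n)) [set: 'I_n]%SET x.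
Proof.
move=> [[/finite_seqP[s SigmaE] simpl _ _] cover]; apply: contrapT => nog.
(* If no full-dimensional cone contains [x], every cone misses the curve for small [t], against
   completeness. *)
have [C|e e0 He] := @eventually_seq R _ s (fun C t => ~ C (x + moment_curve n t)).
  move=> sC; have SC : Sigma C by rewrite SigmaE.
  have [k [g [gfree CE]]] := simpl _ SC; move: gfree CE => /= gfree CE.
  have := rank_leq_col (map_mx intr g : 'M[R]_(k, n)).
  rewrite (eqP gfree) leq_eqVlt => /predU1P[kn|kn]; last first.
    have [u u0 uC] := small_cone_hyperplane (map_mx intr g : 'M[R]_(k, n)) kn.
    have [e e0 He] := moment_curve_avoids_hyperplane x u0.
    by exists e => // t /He /eqP ut; rewrite CE => /uC.
  subst k; have gunit : (map_mx intr g : 'M[R]_n) \in unitmx by rewrite -row_free_unit.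
  have : ~ C x by move=> Cx; apply: nog; exists g => //; rewrite -CE.
  rewrite CE (full_cone_spanP _ gunit) => /existsNP[i /negP].
  rewrite -ltNge => xi.
  (* The dual functional giving the [i]-th coordinate with respect to the generators; it is negative
     at [x]. *)
  pose u := (col i (invmx (map_mx intr g : 'M[R]_n)))^T.
  have uE y : dot u y = (y *m invmx (map_mx intr g : 'M[R]_n)) 0 i.
    by rewrite dot_mx trmxK !mxE; apply: eq_bigr => j _; rewrite !mxE.
  have [|e e0 He] := @moment_curve_lt0 R n u x; first by rewrite uE.
  exists e => // t /He; rewrite uE => ut; rewrite (full_cone_spanP _ gunit).
  by move=> /(_ i); rewrite leNgt ut.
have [C SC Cx] : (\bigcup_(C in Sigma) C) (x + moment_curve n e) by rewrite cover.
apply: (He e _ C) => //; first by rewrite e0 lexx.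
by move: SC; rewrite SigmaE.
Qed.

(** * Rays of full-dimensional cones *)

Definition ray (R : realType) (n : nat) (v : 'rV[R]_n) : set 'rV[R]_n :=
  [set y | exists2 c, 0 <= c & y = c *: v].

Lemma cone_span1 (R : realType) (n : nat) (I : finType) (f : I -> 'rV[R]_n)
    (i : I) :
  cone_span f [set i]%SET = ray (f i).
Proof.
apply/seteqP; split=> y [c c0 ->]; first by exists (c i) => //; rewrite big_set1.
by exists (fun=> c) => //; rewrite big_set1.
Qed.

Lemma ray_scale (R : realType) (n : nat) (v : 'rV[R]_n) (a : R) :
  0 < a -> ray (a *: v) = ray v.
Proof.
move=> a0; apply/seteqP; split=> _ [c c0 ->].
  by exists (c * a); rewrite ?scalerA // mulr_ge0 // ltW.
exists (c / a); first by rewrite divr_ge0 // ltW.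
by rewrite scalerA divfK // gt_eqF.
Qed.

Lemma affdim_ray (R : realType) (n : nat) (v : 'rV[R]_n) :
  v != 0 -> affdim (ray v) 1.
Proof.
move=> v0; exists 0; first by exists 0; rewrite ?scale0r.
exists <<v>>%MS; split=> [|_ [c _ ->]|W HW].
- by rewrite genmxE rank_rV v0.
- by rewrite genmxE subr0 scalemx_sub.
- by rewrite genmxE -[v]subr0; apply: HW; exists 1; rewrite ?scale1r.
Qed.

Lemma full_cone_ray_face (R : realType) (n : nat) (G : 'M[R]_n) (k : 'I_n) :
  G \in unitmx ->
  cone_face (cone_span (fun i => row i G) [set: 'I_n]%SET) (ray (row k G)).
Proof.
move=> uG; pose w : 'cV[R]_n := \col_l (l != k)%:R.
(* The sum of all dual coordinates except the [k]-th. *)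
exists (invmx G *m w)^T.
have dotE y : dot (invmx G *m w)^T y =
    \sum_(l | l != k) (y *m invmx G) 0 l.
  rewrite dot_mx trmxK mulmxA mxE [RHS]big_mkcond; apply: eq_bigr => l _.
  by rewrite [w _ _]mxE; case: eqP; rewrite ?mulr0 ?mulr1.
split=> [y /(full_cone_spanP _ uG) yc|]; first by rewrite dotE sumr_ge0.
apply/seteqP; split=> [_ [c c0 ->]|y [/(full_cone_spanP _ uG) yc]].
  have cE i : (c *: row k G *m invmx G) 0 i = c * (k == i)%:R.
    by rewrite -scalemxAl -row_mul mulmxV // !mxE.
  split; first by apply/(full_cone_spanP _ uG) => i; rewrite cE mulr_ge0.
  by rewrite dotE big1 // => i ik; rewrite cE eq_sym (negbTE ik) mulr0.
rewrite dotE => /psumr_eq0P y0; exists ((y *m invmx G) 0 k) => //.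
rewrite -[LHS](mulmxKV uG) mulmx_sum_row (bigD1 k) //= big1 ?addr0 // => i ik.
by rewrite y0 ?scale0r // => j _.
Qed.

Lemma primitive_neq0 (n : nat) (v : 'rV[int]_n) : primitive v -> v != 0.
Proof.
by move=> pv; apply/negP => /eqP v0; have := pv 2 v; rewrite v0 scaler0 => /(_ erefl).
Qed.

Lemma complete_toric_DM_bases (R : realType) (n m : nat) (B : 'M[int]_(n, m))
    (K : simplicial_complex m) :
  complete_toric_DM R B K ->
  forall s, s \in K -> exists2 t, t \in K & s \subset t /\
     exists2 h : 'I_n -> 'I_m, forall k, h k \in t & \det (colsub h B) != 0.
Proof.
move=> [Sigma [rho [b [beta]]]] /=.
set betaR := fun i => map_mx _ _; move=> [fanS [injrho rangerho] rhoE BE KE] s sK.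
have betaN0 i : betaR i != 0.
  have [_ /primitive_neq0 bi _] := rhoE i; apply: contraNneq bi => bi0.
  apply/eqP/rowP => j; have /rowP/(_ j) := bi0; rewrite !mxE => /eqP.
  by rewrite intr_eq0 => /eqP.
have rho_ray i : rho i = ray (betaR i).
  by have [_ _ ->] := rhoE i; rewrite cone_span1.
have SC : Sigma (cone_span betaR s) by apply/KE.
have betaC i : i \in s -> cone_span betaR s (betaR i).
  move=> si; exists (fun j => (j == i)%:R) => [j|]; first exact: ler0n.
  rewrite (bigD1 i) //= eqxx scale1r big1 ?addr0 // => j /andP[_ /negbTE->].
  by rewrite scale0r.
(* The sum of the generators is interior to their cone: a face of that cone containing it contains
   every generator. *)
have [g gu] := complete_fan_full_cone (\sum_(i in s) betaR i) fanS.
have [[_ _ faceS interS] _] := fanS.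
set G := map_mx intr g in gu *; set D := cone_span _ _ => -[SD Dx].
have DP y : D y <-> forall i, 0 <= (y *m invmx G) 0 i by exact: full_cone_spanP.
have betaD i : i \in s -> D (betaR i).
  move=> si; have [[u [u0 uE]] _] := interS _ _ SC SD.
  suff [] : (cone_span betaR s `&` D) (betaR i) by [].
  rewrite uE; split; first exact: betaC.
  have : (cone_span betaR s `&` D) (\sum_(i in s) betaR i).
    by split => //; exists (fun=> 1) => // ; apply: eq_bigr => j _; rewrite scale1r.
  rewrite uE => -[_]; rewrite dot_sumr => /psumr_eq0P; apply => // j sj.
  exact/u0/betaC.
have row_neq0 k : row k G != 0.
  apply/negP => /eqP rk0; have /rowP/(_ k) := congr1 (mulmx^~ (invmx G)) rk0.
  by rewrite -row_mul mulmxV // mul0mx !mxE eqxx => /eqP; rewrite oner_eq0.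
(* An edge of [D] is a one-dimensional face, so it belongs to the fan and carries a label. *)
have /choice[h hE] : forall k, exists j, rho j = ray (row k G).
  move=> k; suff [j _ <-] : range rho (ray (row k G)) by exists j.
  rewrite rangerho; split; last exact: affdim_ray.
  exact: faceS SD (full_cone_ray_face _ gu).
have /choice[a /all_and2[a0 aE]] : forall k, exists a,
    0 < a /\ betaR (h k) = a *: row k G.
  move=> k; have : ray (row k G) (betaR (h k)).
    by rewrite -hE rho_ray; exists 1; rewrite ?scale1r.
  move=> [c c0 hc]; exists c; split => //; rewrite lt_neqAle c0 andbT.
  by apply: contraNneq (betaN0 (h k)) => c_0; rewrite hc -c_0 scale0r.
pose t := [set h k | k in 'I_n]%SET.
have tE : cone_span betaR t = D.
  apply/seteqP; split=> y.
    move=> [c c0 ->]; apply/DP => i; rewrite mulmx_suml summxE.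
    apply: sumr_ge0 => _ /imsetP[k _ ->].
    rewrite aE -!scalemxAl -row_mul mulmxV // !mxE.
    by rewrite mulr_ge0 // mulr_ge0 // ltW.
  move=> /cone_span_rowsP[c c0 ->].
  (* The coefficients are collected over the fibres of [h] and rescaled from [row k G] to
     [betaR (h k)]. *)
  exists (fun j => \sum_(k | h k == j) c 0 k / a k) => [j|].
    by apply: sumr_ge0 => k _; rewrite divr_ge0 // ltW.
  rewrite mulmx_sum_row (partition_big h (mem t)) /=; last first.
    by move=> k _; rewrite imset_f.
  apply: eq_bigr => j _; rewrite scaler_suml; apply: eq_bigr => k /eqP <-.
  by rewrite aE scalerA divfK // gt_eqF.
exists t; first by apply/KE; rewrite tE.
split.
  apply/subsetP => i si; have Di := betaD i si.
  have Srho : Sigma (rho i).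
    have : range rho (rho i) by exists i.
    by rewrite rangerho => -[].
  (* [u] cuts out the face of [D] lying on ray [i]. It vanishes at [betaR i], hence at some
     generator of [D] occurring in it; that generator lies on ray [i], so the two rays agree. *)
  have [_ [u [u0 uE]]] := interS _ _ Srho SD.
  have : (rho i `&` D) (betaR i).
    by split => //; rewrite rho_ray; exists 1; rewrite ?scale1r.
  rewrite uE => -[_ ui]; have /cone_span_rowsP[c c0 cE] := Di.
  have Drow k : D (row k G).
    apply/DP => l; rewrite -row_mul mulmxV // !mxE; exact: ler0n.
  have [k ck] : exists k, c 0 k != 0.
    apply: contrapT => noc; case/negP: (betaN0 i); rewrite cE.
    suff -> : c = 0 by rewrite mul0mx.
    apply/rowP => k; rewrite [RHS]mxE; apply/eqP/negPn/negP => ck.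
    by apply: noc; exists k.
  have uk : dot u (row k G) = 0.
    move: ui; rewrite cE mulmx_sum_row dot_sumr => /psumr_eq0P /(_ k isT).
    rewrite dotZr => ckk; apply/eqP; move: ckk.
    move=> /(_ _)/eqP; rewrite mulf_eq0 (negbTE ck) /=; apply.
    by move=> l _; rewrite dotZr mulr_ge0 // u0.
  have : (rho i `&` D) (row k G) by rewrite uE; split.
  rewrite rho_ray => -[[d d0 kE] _].
  have dgt0 : 0 < d.
    rewrite lt_neqAle d0 andbT; apply: contraNneq (row_neq0 k) => d_0.
    by rewrite kE -d_0 scale0r.
  suff -> : i = h k by rewrite imset_f.
  by apply: injrho; rewrite hE kE ray_scale // rho_ray.
exists h => [k|]; first by rewrite imset_f.
(* The minor is the invertible generator matrix with columns rescaled by positive numbers: the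
   labels times the factors [a k]. *)
have BG : map_mx intr (colsub h B) =
    G^T *m diag_mx (\row_k ((b (h k))%:R * a k)) :> 'M[R]_n.
  apply/matrixP => i k; rewrite mul_mx_diag !mxE BE mxE rmorphM /=.
  have /rowP/(_ i) := aE k; rewrite !mxE => ->.
  by rewrite mulrA mulrC pmulrn.
have : \det (map_mx intr (colsub h B) : 'M[R]_n) != 0.
  rewrite BG det_mulmx det_tr mulf_neq0 //.
    by move: gu; rewrite unitmxE unitfE.
  rewrite det_diag; apply/prodf_neq0 => k _; rewrite mxE mulf_neq0 //.
    by rewrite pnatr_eq0 -lt0n; have [] := rhoE (h k).
  by rewrite gt_eqF.
by rewrite det_map_mx intr_eq0.
Qed.

Theorem corollary5p10 (R : realType) (n m : nat) (B : 'M[int]_(n, m))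
    (K : simplicial_complex m) :
  torus_surjective R B ->
  quasi_toric R B K \/ complete_toric_DM R B K ->
  torsion_free (face_module B K : lmodType {mpoly int[n]}).
Proof.
move=> _ [/quasi_toric_bases|/complete_toric_DM_bases].
  exact: face_module_torsion_free.
exact: face_module_torsion_free.
Qed.
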